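(* Let $n\ge 2$ and $M\in\mathrm{GL}(n,\mathbb{Z})$, with polynomial invariants $q_1,\dots,q_r$. Then $M$ is reversible in $\mathrm{GL}(n,\mathbb{Q})$ (i.e. there is $G\in\mathrm{GL}(n,\mathbb{Q})$ with $GMG^{-1}=M^{-1}$) if and only if each of the polynomial invariants $q_i$ of $M$ separately satisfies the reciprocity condition $$q_i(x)\;=\;\frac{x^{n_i}}{q_i(0)}\,q_i(1/x),\qquad n_i=\deg q_i .$$ In this situation, the reversing symmetry $G\in \mathrm{GL}(n,\mathbb{Q})$ can be chosen to be an involution.
   Context: $\mathrm{GL}(n,\mathbb{Z})$ is the group of integer $n\times n$ matrices with determinant $\pm1$. The polynomial invariants (invariant factors) of $M$ are defined as follows: set $p_0=1$ and, for $1\le k\le n$, let $p_k$ be the (monic) greatest common divisor of all minors of order $k$ of $x\mathbf{1}-M$, so that $p_n=\det(x\mathbf{1}-M)$. Let $\ell$ be the largest $k$ with $p_k=1$ and put $q_i=p_{\ell+i}/p_{\ell+i-1}$ for $1\le i\le r=n-\ell$. They are monic integer polynomials with $q_i\mid q_{i+1}$ whose product is the characteristic polynomial of $M$; in particular $q_i(0)=\pm1$. The reciprocity condition for a monic polynomial $P$ of degree $n$ that is the characteristic polynomial of an invertible matrix $A$ reads $P(x)=\frac{(-1)^n x^n}{\det(A)}P(1/x)$; since $\det(A)=(-1)^nP(0)$, this is the condition displayed in the claim (applied to $q_i$ and its companion matrix). An involution is a matrix $G$ with $G^2=\mathbf{1}$. *)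

(* Defs.v *)
From mathcomp Require Import all_boot all_order all_algebra.
Set Implicit Arguments.
Unset Strict Implicit.
Unset Printing Implicit Defensive.
Import GRing.Theory.
Local Open Scope ring_scope.

Definition strictly_increasing (k n : nat) (f : {ffun 'I_k -> 'I_n}) : bool :=
  [forall i : 'I_k, forall j : 'I_k, (i < j)%N ==> (f i < f j)%N].

Definition minor (R : comNzRingType) (n k : nat) (B : 'M[R]_n)
    (f g : {ffun 'I_k -> 'I_n}) : R :=
  \det (mxsub f g B).

Section InvariantFactors.
Variables (F : fieldType) (n : nat) (A : 'M[F]_n).

Definition monic_normalize (p : {poly F}) : {poly F} := (lead_coef p)^-1 *: p.

(* p_k, for 0 <= k <= n.  The gcd is taken in F[x]; for F = Q and A an        *)
(* integer matrix it agrees with the monic gcd in Z[x], since the latter      *)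
(* divides the monic polynomial det(x1 - A).                                  *)
Definition det_divisor (k : nat) : {poly F} :=
  monic_normalize
    (\big[@gcdp F/0]_(f : {ffun 'I_k -> 'I_n} | strictly_increasing f)
       \big[@gcdp F/0]_(g : {ffun 'I_k -> 'I_n} | strictly_increasing g)
          minor (char_poly_mx A) f g).

(* The convention p_0 = 1 comes out of the general formula, the only minor of *)
(* order 0 being the determinant of the empty matrix.                         *)
Lemma det_divisor0 : det_divisor 0 = 1.
Proof.
have inc (f : {ffun 'I_0 -> 'I_n}) : strictly_increasing f.
  by apply/forallP => -[].
pose f0 : {ffun 'I_0 -> 'I_n} := ffun0 (card_ord 0).
have f0E : @strictly_increasing 0 n =1 pred1 f0.
  by move=> f; rewrite inc /=; apply/esym/eqP/ffunP => -[].
rewrite /det_divisor !(big_pred1_id _ _ _ f0E) !gcdp0 /minor det_mx00.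
by rewrite /monic_normalize lead_coef1 invr1 scale1r.
Qed.

Definition num_trivial : nat :=
  \max_(k < n.+1 | det_divisor k == 1) k.

Definition num_invariants : nat := n - num_trivial.

(* q_i, meaningful for 1 <= i <= num_invariants; the division is exact.       *)
Definition invariant_factor (i : nat) : {poly F} :=
  det_divisor (num_trivial + i) %/ det_divisor (num_trivial + i).-1.

End InvariantFactors.

Section Reciprocity.
Variable F : fieldType.

Definition constF (c : F) : {fraction {poly F}} := tofrac c%:P.

(* q(x) = x^d / q(0) * q(1/x), with d = deg q, as an identity in the field    *)
(* F(x) of rational functions; q(1/x) is q evaluated there at the inverse of  *)
(* the indeterminate.                                                         *)
Definition reciprocal (q : {poly F}) : Prop :=
  let x : {fraction {poly F}} := tofrac 'X in
  tofrac q = x ^+ (size q).-1 / constF q.[0] * (map_poly constF q).[x^-1].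

End Reciprocity.

Section Reversibility.
Variables (F : fieldType) (n : nat).

Definition reverses (G A : 'M[F]_n) : Prop :=
  G \in unitmx /\ G *m A *m invmx G = invmx A.

Definition reversible (A : 'M[F]_n) : Prop := exists G, reverses G A.

Definition involution (G : 'M[F]_n) : Prop := G *m G = 1%:M.

End Reversibility.

(* Main.v *)
(* Write x1 - M = L D R with L, R invertible over F[x] and
   D = diag(d_1, ..., d_n), d_i | d_(i+1) (Smith form); then p_k is
   d_1 ... d_k up to a scalar and the q_i are the nonconstant d_i.

   If M is reversible, x1 - M and x1 - M^-1 are equivalent and have the same
   p_k.  On the other hand x1 - M^-1 = -x M^-1 (x^-1 1 - M), so every k-minor
   of x1 - M^-1 is, up to a power of x, a multiple of x^(deg p_k) p_k(1/x).
   Hence this polynomial divides p_k; the degrees agree because p_k(0) <> 0,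
   so p_k is reciprocal, and so are the quotients q_i.

   Conversely F^n = F[x]^n / F[x]^n (x1 - M) is the direct sum of cyclic
   modules F[x]/(d_i), generated by the images g_i of the rows of R.  If the
   d_i are reciprocal up to a scalar, d_i(M^-1) kills g_i, so that
   sum_i g_i p_i(M) |-> sum_i g_i p_i(M^-1) is well defined; it is an
   involution conjugating M into M^-1. *)
From HB Require Import structures.
Require Import Defs.
From mathcomp Require Import all_boot all_order all_algebra all_fingroup.
Set Implicit Arguments.
Unset Strict Implicit.
Unset Printing Implicit Defensive.
Import GRing.Theory.
Local Open Scope ring_scope.

(** * Minors and determinantal divisors *)

(** Unsorted Cauchy-Binet formula: multilinear expansion in the rows of the product, over all maps
    [h]. *)
Lemma det_mulmx_rowsub (R : comNzRingType) (k n : nat)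
    (P : 'M[R]_(k, n)) (Q : 'M[R]_(n, k)) :
  \det (P *m Q)
  = \sum_(h : {ffun 'I_k -> 'I_n}) (\prod_i P i (h i)) * \det (rowsub h Q).
Proof.
under [RHS]eq_bigr do rewrite big_distrr /=.
rewrite exchange_big /=; apply: eq_bigr => s _.
under [RHS]eq_bigr do rewrite mulrCA -big_split /=.
rewrite -big_distrr /=; congr (_ * _).
under eq_bigr do rewrite mxE.
rewrite bigA_distr_bigA /=.
by apply: eq_bigr => h _; apply: eq_bigr => i _; rewrite mxE.
Qed.

Lemma sort_minor_rows (R : comNzRingType) (k n : nat) (f : 'I_k -> 'I_n)
    (B : 'M[R]_(n, k)) :
  \det (rowsub f B) = 0 \/
  exists (h : {ffun 'I_k -> 'I_n}) (s : 'S_k),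
    strictly_increasing h /\ \det (rowsub f B) = (-1) ^+ s * \det (rowsub h B).
Proof.
have [/injectivePn [i [j Dij Ef]]|/negPn/injectiveP f_inj] :=
  boolP (~~ injectiveb f).
  left; apply: (determinant_alternate Dij) => l; by rewrite !mxE Ef.
right.
pose leI := relpre val leq : rel 'I_n.
pose t := [tuple f i | i < k].
have /tuple_permP[s ts] : perm_eq t (sort_tuple leI t).
  by rewrite perm_sym perm_sort.
pose h := [ffun i => tnth (sort_tuple leI t) i].
have fE i : f i = h (s i).
  rewrite ffunE -[LHS](tnth_mktuple f) -/t.
  by rewrite (tnth_nth (f i)) ts -tnth_nth tnth_mktuple.
exists h, s; split.
  apply/forallP=> i; apply/forallP=> j; apply/implyP=> lt_ij.
  have h_inj : injective h.
    move=> a b; rewrite -[a](permKV s) -[b](permKV s) -!fE => /f_inj.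
    by move=> ->.
  rewrite ltn_neqAle (inj_eq val_inj) (inj_eq h_inj) -(inj_eq val_inj).
  rewrite (ltn_eqF lt_ij) /= !ffunE !(tnth_nth (f i)) /=.
  have leT : transitive leI by move=> ? ? ?; apply: leq_trans.
  have srt : sorted leI (sort leI t).
    by apply: sort_sorted => a b; apply: leq_total.
  apply: (sorted_leq_nth leT _ (f i) srt);
    rewrite ?inE ?size_sort ?size_tuple //.
  exact: ltnW lt_ij.
have -> : rowsub f B = row_perm s (rowsub h B).
  by apply/matrixP=> i j; rewrite !mxE fE.
by rewrite row_permE det_mulmx det_perm.
Qed.

Section Minors.
Variable F : fieldType.
Implicit Types (p q : {poly F}) (k n : nat).

(** Arbitrary index maps are allowed, since the expansion of the minors of a product produces
    non-increasing ones. *)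
Definition dvd_minors k n q (B : 'M[{poly F}]_n) :=
  forall f g : 'I_k -> 'I_n, q %| \det (mxsub f g B).

Lemma dvdp_sum (I : finType) (P : pred I) q (E : I -> {poly F}) :
  (forall i, P i -> q %| E i) -> q %| \sum_(i | P i) E i.
Proof.
move=> qE; apply: (big_rec (fun p => q %| p)) => [|i p /qE qEi].
  exact: dvdp0.
exact: dvdp_add.
Qed.

Lemma dvdp_big_gcdp (I : finType) (P : pred I) q (E : I -> {poly F}) :
  reflect (forall i, P i -> q %| E i) (q %| \big[@gcdp F/0]_(i | P i) E i).
Proof.
have -> : (q %| \big[@gcdp F/0]_(i | P i) E i) = [forall (i | P i), q %| E i].
  rewrite -big_andE; apply: (big_rec2 (fun b p => (q %| p) = b)) => [|i b p _ <-].
    by rewrite dvdp0.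
  by rewrite dvdp_gcd.
by apply: (iffP forall_inP).
Qed.

Lemma dvd_minors_mull k n q (A B : 'M[{poly F}]_n) :
  dvd_minors k q B -> dvd_minors k q (A *m B).
Proof.
move=> qB f g; rewrite mxsub_mul det_mulmx_rowsub dvdp_sum // => h _.
by rewrite dvdp_mull // -mxsubrc; apply: qB.
Qed.

Lemma dvd_minors_tr k n q (B : 'M[{poly F}]_n) :
  dvd_minors k q B -> dvd_minors k q B^T.
Proof. by move=> qB f g; rewrite -trmx_mxsub det_tr. Qed.

Lemma dvd_minors_mulr k n q (A B : 'M[{poly F}]_n) :
  dvd_minors k q B -> dvd_minors k q (B *m A).
Proof.
move=> qB; rewrite -[B *m A]trmxK trmx_mul.
exact/dvd_minors_tr/dvd_minors_mull/dvd_minors_tr.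
Qed.

(** Sorting the rows, then the columns by transposition, changes a minor only by a sign unless an
    index repeats and the minor vanishes. *)
Lemma dvd_minors_increasing k n q (B : 'M[{poly F}]_n) :
  (forall f g : {ffun 'I_k -> 'I_n}, strictly_increasing f ->
     strictly_increasing g -> q %| minor B f g) ->
  dvd_minors k q B.
Proof.
move=> qB f g; rewrite mxsubrc.
have [->|[h [s [inc_h ->]]]] := sort_minor_rows f (colsub g B).
  by rewrite dvdp0.
rewrite dvdp_mull // -mxsubrc -det_tr trmx_mxsub mxsubrc.
have [->|[h' [s' [inc_h' ->]]]] := sort_minor_rows g (colsub h B^T).
  by rewrite dvdp0.
by rewrite dvdp_mull // -mxsubrc -trmx_mxsub det_tr; apply: qB.
Qed.

Lemma eqp_monic_normalize p : monic_normalize p %= p.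
Proof.
have [->|p0] := eqVneq p 0; first by rewrite /monic_normalize scaler0 eqpxx.
by rewrite /monic_normalize eqp_scale // invr_eq0 lead_coef_eq0.
Qed.

Lemma monic_normalize_monic p : p != 0 -> monic_normalize p \is monic.
Proof.
by move=> p0; rewrite monicE lead_coefZ mulVf // lead_coef_eq0.
Qed.

Lemma det_divisorP k n (A : 'M[F]_n) q :
  reflect (dvd_minors k q (char_poly_mx A)) (q %| det_divisor A k).
Proof.
rewrite (eqp_dvdr _ (eqp_monic_normalize _)); apply: (iffP idP).
  move=> /dvdp_big_gcdp qA; apply: dvd_minors_increasing => f g incf incg.
  by move/dvdp_big_gcdp: (qA f incf); apply.
move=> qA; apply/dvdp_big_gcdp => f _; apply/dvdp_big_gcdp => g _.
exact: qA.
Qed.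

Lemma prod_dvd_minors_diag k n (e : nat -> {poly F}) :
  (forall i j, (i <= j < n)%N -> e i %| e j) ->
  dvd_minors k (\prod_(i < k) e i) (diag_mx (\row_(i < n) e i)).
Proof.
move=> e_dvd; apply: dvd_minors_increasing => f g /forallP incf _.
(* An increasing [f] satisfies [i <= f i], so [e i] divides the entry [e (f i)] in each Leibniz
   term. *)
have le_f (i : 'I_k) : (i <= f i)%N.
  case: i; elim=> // m IHm lt_m1k.
  apply: leq_ltn_trans (IHm (ltnW lt_m1k)) _.
  have /forallP/(_ (Ordinal lt_m1k))/implyP := incf (Ordinal (ltnW lt_m1k)).
  exact.
rewrite dvdp_sum // => s _; rewrite dvdp_mull //.
apply: (big_ind2 (fun a b => a %| b)) => [|? ? ? ?|i _]; rewrite ?dvdpp //.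
  exact: dvdp_mul.
rewrite !mxE mulrb; case: eqP => _; rewrite ?dvdp0 // e_dvd //.
by rewrite le_f ltn_ord.
Qed.

(** Common divisors of the k-minors are unchanged by invertible factors, so both sides can be
    compared on the diagonal matrix, whose leading principal minor is the product. *)
Lemma det_divisor_eqp k n (A : 'M[F]_n) (L R : 'M[{poly F}]_n)
    (e : nat -> {poly F}) :
  (k <= n)%N -> L \in unitmx -> R \in unitmx ->
  char_poly_mx A = L *m diag_mx (\row_i e i) *m R ->
  (forall i j, (i <= j < n)%N -> e i %| e j) ->
  det_divisor A k %= \prod_(i < k) e i.
Proof.
move=> le_kn uL uR AE e_dvd; apply/andP; split; last first.
  apply/det_divisorP; rewrite AE.
  exact/dvd_minors_mulr/dvd_minors_mull/prod_dvd_minors_diag.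
have /det_divisorP dA := dvdpp (det_divisor A k).
have : dvd_minors k (det_divisor A k) (diag_mx (\row_(i < n) e i)).
  have -> : diag_mx (\row_i e i) = invmx L *m (char_poly_mx A *m invmx R).
    by rewrite AE mulmxK // mulKmx.
  exact/dvd_minors_mull/dvd_minors_mulr.
pose w := widen_ord le_kn.
move/(_ w w); congr (_ %| _).
have -> : mxsub w w (diag_mx (\row_i e i)) = diag_mx (\row_(i < k) e i).
  by apply/matrixP => i j; rewrite !mxE.
by rewrite det_diag; apply: eq_bigr => i _; rewrite mxE.
Qed.

End Minors.

(** * Smith normal form over F[x] *)

Section Smith.
Variable F : fieldType.

Definition mx_equiv m n (A B : 'M[{poly F}]_(m, n)) :=
  exists (L : 'M_m) (R : 'M_n),
    [/\ L \in unitmx, R \in unitmx & A = L *m B *m R].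

Lemma mx_equiv_trans m n (A B C : 'M[{poly F}]_(m, n)) :
  mx_equiv A B -> mx_equiv B C -> mx_equiv A C.
Proof.
move=> [L [R [uL uR ->]]] [L' [R' [uL' uR' ->]]].
exists (L *m L'), (R' *m R).
by rewrite !unitmx_mul uL uR uL' uR' !mulmxA.
Qed.

Lemma mx_equiv_mul m n (A : 'M[{poly F}]_(m, n)) L R :
  L \in unitmx -> R \in unitmx -> mx_equiv A (L *m A *m R).
Proof.
move=> uL uR; exists (invmx L), (invmx R); rewrite !unitmx_inv uL uR.
by split=> //; rewrite !mulmxA mulVmx // mul1mx mulmxK.
Qed.

Lemma mx_equiv_tr m n (A B : 'M[{poly F}]_(m, n)) :
  mx_equiv A^T B^T -> mx_equiv A B.
Proof.
move=> [L [R [uL uR AB]]]; exists R^T, L^T; rewrite !unitmx_tr uL uR.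
by split=> //; rewrite -[A]trmxK AB !trmx_mul trmxK mulmxA.
Qed.

Lemma unitmx_lower m n (X : 'M[{poly F}]_(n, m)) :
  block_mx 1%:M 0 X 1%:M \in unitmx.
Proof. by rewrite unitmxE det_lblock !det1 mulr1 unitr1. Qed.

Lemma unitmx_upper m n (X : 'M[{poly F}]_(m, n)) :
  block_mx 1%:M X 0 1%:M \in unitmx.
Proof. by rewrite unitmxE det_ublock !det1 mulr1 unitr1. Qed.

Lemma dvdp_mulmx_entry m n p q (a : {poly F}) (L : 'M_(m, n)) (B : 'M_(n, p))
    (R : 'M_(p, q)) :
  (forall i j, a %| B i j) -> forall i j, a %| (L *m B *m R) i j.
Proof.
move=> aB i j; rewrite mxE.
apply: (big_ind (fun p => a %| p)) => [||k _]; rewrite ?dvdp0 //.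
  exact: dvdp_add.
rewrite mxE; apply: dvdp_mulr.
apply: (big_ind (fun p => a %| p)) => [||l _]; rewrite ?dvdp0 //.
  exact: dvdp_add.
exact: dvdp_mull.
Qed.

(** One Euclidean step: subtracting a multiple of the first column from another leaves the remainder
    of [u 0 j] modulo [a]. *)
Lemma reduce_row m n (a : {poly F}) (u : 'rV_n) (v : 'cV_m) B j :
  a != 0 -> ~~ (a %| u 0 j) ->
  exists2 A' : 'M_(1 + m, 1 + n),
    mx_equiv (block_mx a%:M u v B) A' &
    (exists i j, A' i j != 0 /\ (size (A' i j) < size a)%N).
Proof.
move=> a0 ndv; pose X : 'rV[{poly F}]_n := - ((u 0 j %/ a) *: delta_mx 0 j).
exists (block_mx a%:M u v B *m block_mx 1%:M X 0 1%:M).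
  rewrite -[X in mx_equiv _ (X *m _)]mul1mx.
  by apply: mx_equiv_mul; rewrite ?unitmx1 ?unitmx_upper.
exists (lshift m 0), (rshift 1 j); rewrite mulmx_block block_mxEur.
have -> : (a%:M *m X + u *m 1%:M) 0 j = u 0 j %% a.
  rewrite mulmx1 mul_scalar_mx !mxE !eqxx /= mulr1.
  by rewrite [X in _ + X](divp_eq _ a) mulrN mulrC addKr.
by rewrite ltn_modp a0; split.
Qed.

Lemma reduce_col m n (a : {poly F}) (u : 'rV_n) (v : 'cV_m) B i :
  a != 0 -> ~~ (a %| v i 0) ->
  exists2 A' : 'M_(1 + m, 1 + n),
    mx_equiv (block_mx a%:M u v B) A' &
    (exists i j, A' i j != 0 /\ (size (A' i j) < size a)%N).
Proof.
move=> a0 ndv.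
have [|A' eqA' [i' [j' szA']]] := @reduce_row n m a v^T u^T B^T i a0.
  by rewrite mxE.
exists A'^T; last by exists j', i'; rewrite mxE.
by apply: mx_equiv_tr; rewrite tr_block_mx tr_scalar_mx trmxK.
Qed.

Lemma move_entry n (A : 'M[{poly F}]_(1 + n)) i j :
  exists2 A', mx_equiv A A' & ulsubmx A' = (A i j)%:M.
Proof.
exists (row_perm (tperm i 0) (col_perm (tperm j 0) A)).
  rewrite row_permE col_permE mulmxA.
  by apply: mx_equiv_mul; rewrite unitmx_perm.
apply/matrixP => k l; rewrite !ord1 !mxE eqxx mulr1n.
have -> : lshift n (0 : 'I_1) = 0 by apply: val_inj.
by rewrite !tpermR.
Qed.

(** Induction on the size of a nonzero entry, moved to the corner as [a]: an entry not divisible by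
    [a] leads to a smaller nonzero one. *)
Lemma smith_step n (A : 'M[{poly F}]_(1 + n)) :
  A != 0 -> exists (a : {poly F}) (B : 'M_n),
    mx_equiv A (block_mx a%:M 0 0 B) /\ (forall i j, a %| B i j).
Proof.
case/matrix0Pn => i [j]; have [s] := ubnP (size (A i j)).
elim: s => // s IHs in A i j *; rewrite ltnS => szA nzA.
have [A1 eqA1 ulA1] := move_entry A i j.
suff : exists (a : {poly F}) (B : 'M_n),
    mx_equiv A1 (block_mx a%:M 0 0 B) /\ (forall i j, a %| B i j).
  by move=> [a [B [eqB aB]]]; exists a, B; split=> //;
    apply: mx_equiv_trans eqB.
rewrite -[A1]submxK ulA1; move: (ursubmx A1) (dlsubmx A1) (drsubmx A1).
move: (A i j) szA nzA => a sza nza {A i j A1 eqA1 ulA1} u v B.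
pose small (A : 'M[{poly F}]_(1 + n)) :=
  exists i j, A i j != 0 /\ (size (A i j) < size a)%N.
have IH A (A' : 'M_(1 + n)) : mx_equiv A A' -> small A' ->
    exists (a : {poly F}) (B : 'M_n),
      mx_equiv A (block_mx a%:M 0 0 B) /\ (forall i j, a %| B i j).
  move=> eqA [i [j [nz lts]]].
  have [a' [B' [eqB' aB']]] := IHs _ _ _ (leq_trans lts sza) nz.
  by exists a', B'; split=> //; apply: mx_equiv_trans eqB'.
have [/forallP/= au|/forallPn[j ndv]] :=
    boolP [forall j, a %| u 0 j]; last first.
  by have [A' eqA'] := reduce_row v B nza ndv; apply: IH eqA'.
have [/forallP/= av|/forallPn[i ndv]] :=
    boolP [forall i, a %| v i 0]; last first.
  by have [A' eqA'] := reduce_col u B nza ndv; apply: IH eqA'.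
(* The first row and column are now multiples of [a]; clearing them leaves the Schur complement
   [C]. *)
pose u' := map_mx (fun p => p %/ a) u; pose v' := map_mx (fun p => p %/ a) v.
have uE : u = a *: u'.
  by apply/rowP=> j; rewrite !mxE mulrC divpK.
have vE : v = a *: v'.
  by apply/colP=> j; rewrite !mxE mulrC divpK.
pose C := B - v' *m u.
have eqC : mx_equiv (block_mx a%:M u v B) (block_mx a%:M 0 0 C).
  exists (block_mx 1%:M 0 v' 1%:M), (block_mx 1%:M u' 0 1%:M).
  rewrite unitmx_lower unitmx_upper; split=> //.
  rewrite !mulmx_block !(mulmx0, mul0mx, mulmx1, mul1mx, addr0, add0r).
  rewrite mul_scalar_mx -uE mul_mx_scalar -vE.
  by rewrite vE -scalemxAl scalemxAr -uE addrC subrK.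
have [/'forall_forallP aC|] := boolP [forall i, forall j, a %| C i j].
  by exists a, C.
rewrite negb_forall => /existsP[i]; rewrite negb_forall => /existsP[j ndv].
(* Adding row [i] of [C] to the top row brings the bad entry next to [a], where division applies. *)
have [|A' eqA' smA'] := @reduce_row n n a (row i C) 0 C j nza.
  by rewrite mxE.
apply: IH smA'; apply: mx_equiv_trans eqC _; apply: mx_equiv_trans eqA'.
pose L : 'M[{poly F}]_(1 + n) := block_mx 1%:M (delta_mx 0 i) 0 1%:M.
have -> : block_mx a%:M (row i C) 0 C = L *m block_mx a%:M 0 0 C *m 1%:M.
  rewrite mulmx1 mulmx_block !(mulmx0, mul0mx, mulmx1, mul1mx, addr0, add0r).
  by rewrite rowE.
by apply: mx_equiv_mul; rewrite ?unitmx1 ?unitmx_upper.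
Qed.

Lemma smith_normal_form n (A : 'M[{poly F}]_n) :
  exists d : 'rV[{poly F}]_n, mx_equiv A (diag_mx d) /\
    (forall i j : 'I_n, (i <= j)%N -> d 0 i %| d 0 j).
Proof.
elim: n A => [|n IHn] A.
  by exists 0; split=> [|[]//]; exists 1%:M, 1%:M; rewrite unitmx1 !flatmx0.
have [->|nzA] := eqVneq A 0.
  exists 0; split=> [|i j _]; last by rewrite !mxE.
  by exists 1%:M, 1%:M; rewrite unitmx1 mul1mx mulmx1 linear0.
have [a [B [eqA aB]]] := @smith_step n A nzA.
have [d [[L [R [uL uR BE]]] dvd_d]] := IHn B.
have DE : diag_mx d = invmx L *m B *m invmx R.
  by rewrite BE !mulmxA mulVmx // mul1mx mulmxK.
have ad i : a %| d 0 i.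
  have := dvdp_mulmx_entry (invmx L) (invmx R) aB i i.
  by rewrite -DE !mxE eqxx mulr1n.
exists (row_mx a%:M d : 'rV_(1 + n)); split.
  apply: mx_equiv_trans eqA _.
  exists (block_mx 1%:M 0 0 L), (block_mx 1%:M 0 0 R).
  rewrite !unitmxE !det_ublock !det1 !mul1r -!unitmxE uL uR; split=> //.
  have -> := @diag_mx_row _ n 1 a%:M d.
  rewrite !mulmx_block.
  rewrite !(mulmx0, mul0mx, mulmx1, mul1mx, addr0, add0r) -BE.
  by congr block_mx; apply/matrixP => i j; rewrite !ord1 !mxE.
move=> i j; rewrite -[i](@splitK 1 n) -[j](@splitK 1 n).
case: (@split 1 n i) => i'; case: (@split 1 n j) => j' //=.
- by rewrite !ord1.
- by rewrite (@row_mxEl _ 1 1 n) (@row_mxEr _ 1 1 n) mxE !ord1 mulr1n.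
- by rewrite ord1.
by rewrite !(@row_mxEr _ 1 1 n) => le_ij; apply: dvd_d; rewrite -(leq_add2l 1).
Qed.

End Smith.

(** * Reciprocal polynomials *)

Lemma constF_is_zmod_morphism (F : fieldType) : zmod_morphism (@constF F).
Proof. by move=> a b; rewrite /constF !rmorphB. Qed.

Lemma constF_is_monoid_morphism (F : fieldType) : monoid_morphism (@constF F).
Proof. by split=> [|a b]; rewrite /constF ?rmorph1 // !rmorphM. Qed.

HB.instance Definition _ (F : fieldType) :=
  GRing.isZmodMorphism.Build F {fraction {poly F}} (@constF F)
    (@constF_is_zmod_morphism F).
HB.instance Definition _ (F : fieldType) :=
  GRing.isMonoidMorphism.Build F {fraction {poly F}} (@constF F)
    (@constF_is_monoid_morphism F).

Section Reciprocal.
Variable F : fieldType.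
Implicit Types (p q : {poly F}) (s : nat).

(** This is x^s q(1/x) when deg q <= s. *)
Definition revp s q : {poly F} := \poly_(i < s.+1) q`_(s - i).

(** The target ring is general so as to cover both F(x) and the matrix algebra. *)
Lemma horner_revp (S : unitRingType) (f : {rmorphism F -> S}) s q (a : S) :
  a \is a GRing.unit -> (size q <= s.+1)%N ->
  (map_poly f (revp s q)).[a] = (map_poly f q).[a^-1] * a ^+ s.
Proof.
move=> ua szq.
have le_rev : (size (map_poly f (revp s q)) <= s.+1)%N.
  by rewrite (leq_trans (size_poly _ _)) // size_poly.
have le_q : (size (map_poly f q) <= s.+1)%N.
  by rewrite (leq_trans (size_poly _ _)).
rewrite (horner_coef_wide _ le_rev) (horner_coef_wide _ le_q) mulr_suml.
rewrite (reindex_inj rev_ord_inj) /=; apply: eq_bigr => i _.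
rewrite !coef_map coef_poly /= subSS ltnS leq_subr subKn ?leq_ord //.
rewrite -mulrA; congr (_ * _).
by rewrite exprVn -[X in _ * a ^+ X](subnKC (leq_ord i)) exprD mulKr // unitrX.
Qed.

Local Notation x := (tofrac 'X : {fraction {poly F}}).

(** The substitution of 1/x for x, packaged as a ring morphism so that it commutes with
    determinants. *)
Definition ev_inv : {poly F} -> {fraction {poly F}} :=
  horner_eval x^-1 \o map_poly (@constF F).
HB.instance Definition _ := GRing.RMorphism.copy ev_inv
  (horner_eval x^-1 \o map_poly (@constF F)).

Lemma tofracX_neq0 : tofrac ('X : {poly F}) != 0.
Proof. by rewrite tofrac_eq0 polyX_eq0. Qed.

Lemma constF_eq0 (a : F) : (constF a == 0) = (a == 0).
Proof. by rewrite tofrac_eq0 polyC_eq0. Qed.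

Lemma tofrac_horner p : tofrac p = (map_poly (@constF F) p).[x].
Proof.
elim/poly_ind: p => [|p c IHp]; first by rewrite !rmorph0 horner0.
rewrite !rmorphD !rmorphM /= map_polyX map_polyC !hornerE IHp.
by [].
Qed.

Lemma tofrac_revp s p : (size p <= s.+1)%N ->
  tofrac (revp s p) = ev_inv p * x ^+ s.
Proof.
by move=> szp; rewrite tofrac_horner horner_revp // unitfE tofracX_neq0.
Qed.

Lemma reciprocalE q :
  reciprocal q = (tofrac q = x ^+ (size q).-1 / constF q.[0] * ev_inv q).
Proof. by []. Qed.

Lemma reciprocal_revp q :
  q.[0] != 0 -> reciprocal q <-> q.[0] *: q = revp (size q).-1 q.
Proof.
move=> q0; rewrite reciprocalE mulrAC mulrC [x ^+ _ * _]mulrC.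
rewrite -tofrac_revp ?leqSpred // -mul_polyC.
have c0 : constF q.[0] != 0 by rewrite constF_eq0.
split=> [E|E].
  apply/eqP; rewrite -tofrac_eq tofracM E mulrA divff // mul1r.
  exact: eqxx.
by apply: (mulfI c0); rewrite mulrA divff // mul1r -E tofracM.
Qed.

Lemma reciprocal_horner0 q : q != 0 -> reciprocal q -> q.[0] != 0.
Proof.
move=> nzq; apply: contraPneq => q0.
(* The inverse of 0 is 0 by convention, so q(0) = 0 would make the right-hand side vanish. *)
rewrite reciprocalE q0 [constF 0]rmorph0 invr0 mulr0 mul0r => /eqP.
by rewrite tofrac_eq0 (negPf nzq).
Qed.

Lemma reciprocal1 : reciprocal (1 : {poly F}).
Proof.
rewrite reciprocalE size_poly1 hornerC !rmorph1 expr0.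
by rewrite mul1r invr1 mulr1.
Qed.

(** Degree is additive, and constant term and substitution are multiplicative, so the identity for p
    cancels from that for q p. *)
Lemma reciprocal_factor p q : p != 0 -> q != 0 ->
  reciprocal p -> reciprocal (q * p) -> reciprocal q.
Proof.
move=> nzp nzq; rewrite !reciprocalE => pE.
have sz : (size (q * p)).-1 = ((size q).-1 + (size p).-1)%N.
  rewrite size_mul // -!subn1; move: nzp nzq; rewrite -!size_poly_gt0.
  by case: (size q) => // a; case: (size p) => // b; rewrite !subn1 addnS.
have fp : tofrac p != 0 by rewrite tofrac_eq0.
rewrite sz hornerM [constF _]rmorphM [ev_inv _]rmorphM tofracM invfM.
rewrite exprD => qpE.
apply: (mulIf fp); rewrite qpE [in RHS]pE /=.
by rewrite [RHS]mulrACA; congr (_ * _); rewrite mulrACA.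
Qed.

(** With d = deg q, reciprocity evaluated at A^-1 reads q(A^-1) = q(0)^-1 q(A) A^-d; hence row
    vectors killed by q(A) are killed by q(A^-1). *)
Lemma horner_mx_invmx_reciprocal n (A : 'M[F]_n.+1) q :
  A \in unitmx -> q != 0 -> reciprocal q ->
  exists B, horner_mx (invmx A) q = horner_mx A q *m B.
Proof.
move=> uA nzq recq; have q0 := reciprocal_horner0 nzq recq.
move/(reciprocal_revp q0): recq => qE.
exists (q.[0]^-1 *: (invmx A) ^+ (size q).-1).
have -> : horner_mx (invmx A) q
    = q.[0]^-1 *: horner_mx (invmx A) (revp (size q).-1 q).
  by rewrite -qE linearZ /= scalerA mulVf // scale1r.
rewrite -scalemxAr; congr (_ *: _).
have uA' : (invmx A : 'M_n.+1) \is a GRing.unit by rewrite unitrV.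
by rewrite [LHS](horner_revp _ uA' (leqSpred _)) invrK.
Qed.

End Reciprocal.

(** * The module F^n over F[x] *)

Section Action.
Variables (F : fieldType) (n : nat).
Implicit Types (A B : 'M[F]_n.+1).

(** The F[x]-linear map from F[x]^m to F^n sending the basis to the rows of [g], where x acts on row
    vectors as right multiplication by [A]. *)
Definition act A m (g : 'M[F]_(m, n.+1)) (w : 'rV[{poly F}]_m) : 'rV[F]_n.+1 :=
  \sum_i row i g *m horner_mx A (w 0 i).

Lemma act_is_zmod_morphism A m (g : 'M_(m, n.+1)) : zmod_morphism (act A g).
Proof.
move=> v w; rewrite /act -sumrB; apply: eq_bigr => i _.
by rewrite !mxE rmorphB mulmxBr.
Qed.

HB.instance Definition _ A m (g : 'M_(m, n.+1)) :=
  GRing.isZmodMorphism.Build 'rV[{poly F}]_m 'rV[F]_n.+1 (act A g)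
    (act_is_zmod_morphism A g).

Lemma actZ A m (g : 'M_(m, n.+1)) p w :
  act A g (p *: w) = act A g w *m horner_mx A p.
Proof.
rewrite mulmx_suml; apply: eq_bigr => i _.
by rewrite mxE mulrC rmorphM mulmxA.
Qed.

Lemma act_delta A m (g : 'M_(m, n.+1)) i : act A g (delta_mx 0 i) = row i g.
Proof.
rewrite /act (bigD1 i) //= big1 ?addr0 => [|j ji].
  by rewrite mxE !eqxx rmorph1 mulmx1.
by rewrite mxE (negPf ji) andbF rmorph0 mulmx0.
Qed.

Definition actm A m p (g : 'M[F]_(m, n.+1)) (P : 'M[{poly F}]_(p, m)) :=
  \matrix_i act A g (row i P).

Lemma act_mulmx A m p (g : 'M_(m, n.+1)) (P : 'M_(p, m)) w :
  act A g (w *m P) = act A (actm A g P) w.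
Proof.
rewrite mulmx_sum_row raddf_sum; apply: eq_bigr => i _.
by rewrite /= actZ rowK.
Qed.

Lemma act_const A m (g : 'M_(m, n.+1)) (u : 'rV[F]_m) :
  act A g (map_mx polyC u) = u *m g.
Proof.
rewrite mulmx_sum_row; apply: eq_bigr => i _.
by rewrite mxE horner_mx_C mul_mx_scalar.
Qed.

Lemma act_comm A B m (g : 'M_(m, n.+1)) w :
  comm_mx B A -> act A g w *m B = act A (g *m B) w.
Proof.
move=> cBA; rewrite mulmx_suml; apply: eq_bigr => i _.
by rewrite row_mul -!mulmxA; congr (_ *m _); rewrite -comm_mx_horner.
Qed.

(** The rows of x1 - A express the relations x e_i = e_i A. *)
Lemma act_char_poly_mx A (w : 'rV_n.+1) : act A 1%:M (w *m char_poly_mx A) = 0.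
Proof.
rewrite act_mulmx (_ : actm A _ _ = 0) /act.
  by rewrite big1 // => i _; rewrite linear0 mul0mx.
apply/row_matrixP => i; rewrite rowK linear0 linearB /=.
rewrite raddfB /= -map_row act_const mulmx1.
have -> : row i 'X%:M = 'X *: delta_mx 0 i :> 'rV[{poly F}]_n.+1.
  by rewrite -scalemx1 linearZ /= row1.
by rewrite actZ act_delta horner_mx_X -row_mul mul1mx subrr.
Qed.

(** Matrix remainder theorem, by Horner's scheme: x p - p(A) A = x (p - p(A)) + p(A) (x - A). *)
Lemma sub_horner_mx_dvd A p :
  exists W, p%:M - map_mx polyC (horner_mx A p) = W *m char_poly_mx A.
Proof.
elim/poly_ind: p => [|p c [W IHp]].
  by exists 0; rewrite mul0mx !rmorph0 subrr.
exists ('X *: W + map_mx polyC (horner_mx A p)).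
rewrite mulmxDl -scalemxAl -IHp !rmorphD !rmorphM /= horner_mx_X horner_mx_C.
rewrite map_scalar_mx opprD addrACA subrr addr0 -!mulmxE mul_mx_scalar.
rewrite /char_poly_mx mulmxBr mul_mx_scalar scalerBr addrA; congr (_ - _).
by rewrite subrK.
Qed.

(** Modulo the rows of x1 - A every vector is constant, so these rows generate all relations among
    the e_i. *)
Lemma sub_act_dvd A (w : 'rV_n.+1) :
  exists w', w - map_mx polyC (act A 1%:M w) = w' *m char_poly_mx A.
Proof.
have -> : w - map_mx polyC (act A 1%:M w) =
    \sum_i row i ((w 0 i)%:M - map_mx polyC (horner_mx A (w 0 i))).
  rewrite /act raddf_sum {1}[w]row_sum_delta -sumrB; apply: eq_bigr => i _.
  by rewrite linearB /= -[(w 0 i)%:M]scalemx1 linearZ /= !row1 -map_row -rowE.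
apply: (big_ind (fun v => exists w', v = w' *m char_poly_mx A)).
- by exists 0; rewrite mul0mx.
- by move=> _ _ [v ->] [v' ->]; exists (v + v'); rewrite mulmxDl.
by move=> i _; have [W ->] := sub_horner_mx_dvd A (w 0 i); exists (row i W);
  rewrite row_mul.
Qed.

End Action.

(* With respect to the generators [g] of the cyclic summands of F^n, [G] maps
   [sum_i g_i p_i(A)] to [sum_i g_i p_i(A^-1)]. *)
Lemma involution_of_smith (F : fieldType) (n : nat) (A : 'M[F]_n.+1)
    (L R : 'M[{poly F}]_n.+1) (d : 'rV[{poly F}]_n.+1) :
  A \in unitmx -> L \in unitmx -> R \in unitmx ->
  char_poly_mx A = L *m diag_mx d *m R ->
  (forall i, exists B,
     horner_mx (invmx A) (d 0 i) = horner_mx A (d 0 i) *m B) ->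
  exists G, reverses G A /\ involution G.
Proof.
move=> uA uL uR AE d_inv; pose g := actm A 1%:M R; pose A' := invmx A.
have actR w : act A 1%:M w = act A g (w *m invmx R).
  by rewrite -act_mulmx mulmxKV.
have rel_g i : row i g *m horner_mx A (d 0 i) = 0.
  rewrite -(act_delta A) -actZ -act_mulmx.
  (* As D R = L^-1 (x1 - A), the vector d_i e_i R is a relation. *)
  have -> : (d 0 i *: delta_mx 0 i) *m R
      = (delta_mx 0 i : 'rV_n.+1) *m invmx L *m char_poly_mx A.
    rewrite AE !mulmxA mulmxKV //; congr (_ *m _).
    by rewrite -rowE row_diag_mx.
  exact: act_char_poly_mx.
(* By [d_inv], the relations of the generators persist when x acts by A^-1. *)
have rel_g' w : act A' g (w *m diag_mx d) = 0.
  rewrite mul_mx_diag /act big1 // => i _; rewrite mxE mulrC rmorphM mulmxA /=.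
  by have [B dB] := d_inv i; rewrite /A' dB mulmxA rel_g !mul0mx.
(* Row i of R^-1 holds the coordinates of e_i on the generators; they are evaluated at A^-1. *)
pose G := actm A' g (invmx R).
(* Well-definedness: [w] differs from a constant vector by some w' L D R, which [act A' G] sends to
   [act A' g] of w' L D, that is to 0. *)
have GE w : act A' G w = act A 1%:M w *m G.
  have [w' /eqP] := sub_act_dvd A w; rewrite subr_eq addrC => /eqP {1}->.
  rewrite raddfD /= act_const -[RHS]addr0; congr (_ + _).
  by rewrite -act_mulmx AE !mulmxA mulmxK // rel_g'.
have AG : A *m G = G *m A'.
  apply/row_matrixP => i; rewrite !row_mul; have := GE ('X *: delta_mx 0 i).
  by rewrite !actZ !act_delta !horner_mx_X -[row i _ *m A]row_mul mul1mx => ->.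
have GA : G *m A = A' *m G by rewrite -[G in LHS](mulKmx uA) AG !mulmxA mulmxKV.
have gG : g *m G = g.
  apply/row_matrixP => i; rewrite row_mul rowK -GE -act_mulmx -row_mul.
  by rewrite mulmxV // row1 act_delta rowK.
(* G^2 commutes with A and fixes the generators of F^n. *)
have GG : G *m G = 1%:M.
  have cGG : comm_mx (G *m G) A.
    by rewrite /comm_mx -[LHS]mulmxA GA [LHS]mulmxA -AG mulmxA.
  apply/row_matrixP => i; rewrite -[G *m G]mul1mx row_mul.
  have -> : row i 1%:M = act A g (delta_mx 0 i *m invmx R).
    by rewrite -actR act_delta.
  by rewrite act_comm // mulmxA !gG.
exists G; split=> //; have uG : G \in unitmx by case/mulmx1_unit: GG.
by split=> //; rewrite GA mulmxK.
Qed.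

(** * Reversibility *)

Section Invertible.
Variables (F : fieldType) (n : nat).
Implicit Type A : 'M[F]_n.+1.

(** The diagonal is indexed by [nat], so that products of its first k entries need no casts. *)
Lemma char_poly_smith A :
  exists (L R : 'M[{poly F}]_n.+1) (e : nat -> {poly F}),
    [/\ L \in unitmx, R \in unitmx,
        char_poly_mx A = L *m diag_mx (\row_i e i) *m R &
        forall i j, (i <= j < n.+1)%N -> e i %| e j].
Proof.
have [d [[L [R [uL uR AE]]] dvd_d]] := smith_normal_form (char_poly_mx A).
exists L, R, (fun i => d 0 (inord i)); split=> // [|i j /andP[le_ij lt_j]].
  rewrite AE; congr (_ *m diag_mx _ *m _).
  by apply/rowP=> i; rewrite mxE inord_val.
by apply: dvd_d; rewrite !inordK // (leq_ltn_trans le_ij).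
Qed.

Lemma dvdp_det_divisor A k l :
  (k <= l <= n.+1)%N -> det_divisor A k %| det_divisor A l.
Proof.
case/andP=> le_kl le_ln; have [L [R [e [uL uR AE e_dvd]]]] := char_poly_smith A.
rewrite (eqp_dvdl _ (det_divisor_eqp (leq_trans le_kl le_ln) uL uR AE e_dvd)).
rewrite (eqp_dvdr _ (det_divisor_eqp le_ln uL uR AE e_dvd)).
by rewrite -(subnKC le_kl) big_split_ord /= dvdp_mulr.
Qed.

Lemma dvdp_det_divisor_char_poly A k :
  (k <= n.+1)%N -> det_divisor A k %| char_poly A.
Proof.
move=> le_kn; apply: dvdp_trans (dvdp_det_divisor A (_ : (k <= n.+1 <= _)%N)) _.
  by rewrite le_kn leqnn.
have /det_divisorP/(_ id id) := dvdpp (det_divisor A n.+1).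
by rewrite mxsub_id.
Qed.

Lemma det_divisor_neq0 A k : (k <= n.+1)%N -> det_divisor A k != 0.
Proof.
move/(dvdp_det_divisor_char_poly A); apply: contraTneq => ->.
by rewrite dvd0p monic_neq0 ?char_poly_monic.
Qed.

Lemma det_divisor_monic A k : (k <= n.+1)%N -> det_divisor A k \is monic.
Proof.
move/(det_divisor_neq0 A); rewrite /det_divisor => nz.
apply: monic_normalize_monic; apply: contraNneq nz => ->.
by rewrite /monic_normalize scaler0.
Qed.

Lemma det_divisor_horner0 A k : (k <= n.+1)%N -> A \in unitmx ->
  (det_divisor A k).[0] != 0.
Proof.
move/(dvdp_det_divisor_char_poly A)/dvdpP => [q qE].
rewrite unitmxE unitfE; apply: contraNneq => p0.
have : (char_poly A).[0] = 0 by rewrite qE hornerM p0 mulr0.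
rewrite horner_coef0 char_poly_det => /eqP.
by rewrite mulf_eq0 signr_eq0.
Qed.

(** * Reciprocity of the determinantal divisors *)

Lemma map_ev_inv_char_poly_mx A : A \in unitmx ->
  map_mx (@ev_inv F) (map_mx polyC (invmx A) *m char_poly_mx A)
  = - (tofrac 'X)^-1 *: map_mx (@tofrac _) (char_poly_mx (invmx A)).
Proof.
move=> uA; rewrite /char_poly_mx mulmxBr -map_mxM mulVmx // mul_mx_scalar.
apply/matrixP => i j; rewrite !mxE.
rewrite !rmorphB !rmorphM !rmorphMn !rmorph1 /=.
have -> : ev_inv 'X = (tofrac ('X : {poly F}))^-1.
  by rewrite /ev_inv /= /horner_eval map_polyX hornerX.
have -> c : ev_inv c%:P = constF c.
  by rewrite /ev_inv /= /horner_eval map_polyC hornerC.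
by rewrite mulNr mulrBr opprB mulrnAr mulVf ?tofracX_neq0 //.
Qed.

Lemma revp_dvd_minors A k : (k <= n.+1)%N -> A \in unitmx ->
  let p := det_divisor A k in
  dvd_minors k (revp (size p).-1 p) (char_poly_mx (invmx A)).
Proof.
move=> le_kn uA p f g; set m := \det _; pose B := map_mx polyC (invmx A).
pose b0 := \det (mxsub f g (B *m char_poly_mx A)).
have /dvdpP[b bE] : p %| b0.
  have /det_divisorP dA := dvdpp p.
  exact: dvd_minors_mull.
pose x : {fraction {poly F}} := tofrac 'X.
have nzx : x != 0 by apply: tofracX_neq0.
(* Substituting 1/x turns A^-1 (x1 - A) into -x^-1 (x1 - A^-1). *)
have mE : tofrac m = (- x) ^+ k * ev_inv b0.
  rewrite /b0 -[ev_inv _]det_map_mx map_mxsub map_ev_inv_char_poly_mx //.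
  have -> (a : {fraction {poly F}}) (C : 'M_n.+1) :
      mxsub f g (a *: C) = a *: mxsub f g C.
    by apply/matrixP=> i j; rewrite !mxE.
  rewrite detZ mulrA -exprMn mulrNN mulfV // expr1n mul1r.
  by rewrite -map_mxsub det_map_mx.
have nzp := det_divisor_neq0 A le_kn.
(* The constant term of the reversed polynomial is the leading coefficient of p, so powers of x can
   be cancelled. *)
have cop N : coprimep (revp (size p).-1 p) ('X ^+ N).
  apply: coprimep_expr; rewrite coprimepX.
  by rewrite /root horner_coef0 coef_poly subn0 -lead_coefE lead_coef_eq0.
rewrite -(Gauss_dvdpr _ (cop ((size p).-1 + size b)%N)).
have -> : 'X ^+ ((size p).-1 + size b) * m
    = (- 'X) ^+ k * revp (size b) b * revp (size p).-1 p.
  apply/eqP; rewrite -tofrac_eq !tofracM !tofracXn tofracN mE bE.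
  rewrite !tofrac_revp ?leqSpred // rmorphM exprD /=.
  apply/eqP; rewrite mulrCA -[RHS]mulrA; congr (_ * _).
  by rewrite [RHS]mulrACA [LHS]mulrC; congr (_ * _); apply: mulrC.
exact: dvdp_mull.
Qed.

Lemma char_poly_mx_conj A A' (G : 'M[F]_n.+1) : G \in unitmx ->
  G *m A *m invmx G = A' ->
  char_poly_mx A = map_mx polyC (invmx G) *m char_poly_mx A' *m map_mx polyC G.
Proof.
move=> uG <-; rewrite /char_poly_mx mulmxBr mulmxBl -!map_mxM !mulmxA mulVmx //.
rewrite mul1mx mulmxKV //; congr (_ - _).
by rewrite mul_mx_scalar -scalemxAl -map_mxM mulVmx // map_mx1 scalemx1.
Qed.

(** Conjugacy makes the reversal of p divide p; as p(0) is nonzero the sizes agree, and leading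
    coefficients give the factor p(0). *)
Lemma det_divisor_reciprocal A k : (k <= n.+1)%N -> A \in unitmx ->
  reversible A -> reciprocal (det_divisor A k).
Proof.
move=> le_kn uA [G [uG GA]]; set p := det_divisor A k.
have nzp : p.[0] != 0 by apply: det_divisor_horner0.
have dvd_rev : revp (size p).-1 p %| p.
  apply/det_divisorP; rewrite (char_poly_mx_conj uG GA).
  exact/dvd_minors_mulr/dvd_minors_mull/revp_dvd_minors.
have lead_rev : p`_((size p).-1 - (size p).-1) != 0.
  by rewrite subnn -horner_coef0.
have sz_rev : size (revp (size p).-1 p) = size p.
  rewrite size_poly_eq // prednK // size_poly_gt0.
  exact: det_divisor_neq0.
apply/reciprocal_revp => //.
have /eqp_eq : p %= revp (size p).-1 p.
  by rewrite eqp_sym -(dvdp_size_eqp dvd_rev) sz_rev.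
rewrite (monicP (det_divisor_monic A le_kn)) scale1r => <-.
by rewrite lead_coef_poly // subnn -horner_coef0.
Qed.

(** * Passage to the invariant factors *)

Lemma num_trivial_leq A : (num_trivial A <= n.+1)%N.
Proof. by apply/bigmax_leqP => i _; rewrite -ltnS. Qed.

Lemma det_divisor_num_trivial A : det_divisor A (num_trivial A) = 1.
Proof.
(* The maximum is attained because p_0 = 1. *)
have nontrivial : (0 < #|[pred k : 'I_n.+2 | det_divisor A k == 1%R]|)%N.
  by apply/card_gt0P; exists ord0; rewrite inE /= det_divisor0.
have [k pk1] := eq_bigmax_cond (fun k : 'I_n.+2 => val k) nontrivial.
by rewrite /num_trivial => ->; apply/eqP.
Qed.

Lemma invariant_factorM A i : (1 <= i <= num_invariants A)%N ->
  det_divisor A (num_trivial A + i)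
  = invariant_factor A i * det_divisor A (num_trivial A + i).-1.
Proof.
move=> /andP[i0 le_i]; rewrite divpK // dvdp_det_divisor // leq_pred /=.
by rewrite -leq_subRL // num_trivial_leq.
Qed.

Lemma invariant_factor_reciprocal A i : A \in unitmx -> reversible A ->
  (1 <= i <= num_invariants A)%N -> reciprocal (invariant_factor A i).
Proof.
move=> uA revA i_bd; have := invariant_factorM i_bd.
set k := (num_trivial A + i)%N => kE.
have le_kn : (k <= n.+1)%N.
  by case/andP: i_bd => _ le_i; rewrite -leq_subRL // num_trivial_leq.
have le_k1n : (k.-1 <= n.+1)%N by apply: leq_trans (leq_pred _) le_kn.
apply: (@reciprocal_factor _ (det_divisor A k.-1)).
- exact: det_divisor_neq0.
- apply: contraNneq (det_divisor_neq0 A le_kn) => q0.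
  by rewrite kE q0 mul0r.
- exact: det_divisor_reciprocal.
by rewrite -kE; apply: det_divisor_reciprocal.
Qed.

(** Each Smith entry is associated with 1 or with an invariant factor, hence with a reciprocal
    polynomial. *)
Lemma reversing_involution A : A \in unitmx ->
  (forall i, (1 <= i <= num_invariants A)%N ->
     reciprocal (invariant_factor A i)) ->
  exists G, reverses G A /\ involution G.
Proof.
move=> uA rec; have [L [R [e [uL uR AE e_dvd]]]] := char_poly_smith A.
have pE k (le_kn : (k <= n.+1)%N) := det_divisor_eqp le_kn uL uR AE e_dvd.
apply: (involution_of_smith uA uL uR AE) => i; rewrite mxE.
have [q [nzq recq qe]] :
    exists q : {poly F}, [/\ q != 0, reciprocal q & q %= e i].
  have [lt_i|le_i] := ltnP i (num_trivial A).
    exists 1; split; [exact: oner_neq0 | exact: reciprocal1 |].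
    rewrite eqp_sym -size_poly_eq1 -dvdp1 -(det_divisor_num_trivial A).
    rewrite (eqp_dvdr _ (pE _ (num_trivial_leq A))).
    by rewrite (bigD1 (Ordinal lt_i)) //= dvdp_mulr.
  (* Diagonal entries are counted from 0 and invariant factors from 1: [e i] is p_(i+1) / p_i up to
     a scalar. *)
  pose j := (i.+1 - num_trivial A)%N.
  have jE : (num_trivial A + j = i.+1)%N by rewrite subnKC // ltnW.
  have j_bd : (1 <= j <= num_invariants A)%N.
    by rewrite subn_gt0 ltnS le_i leq_sub2r.
  have := invariant_factorM j_bd; rewrite jE /= => qE.
  have nzp := det_divisor_neq0 A (ltn_ord i).
  exists (invariant_factor A j); split; last 1 first.
  - have le_in : (i <= n.+1)%N by apply: ltnW.
    rewrite -(eqp_mul2r _ _ (det_divisor_neq0 A le_in)) -qE.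
    apply: eqp_trans (pE _ (ltn_ord i)) _.
    by rewrite big_ord_recr /= mulrC eqp_mull // eqp_sym pE.
  - by apply: contraNneq nzp => q0; rewrite qE q0 mul0r.
  exact: rec.
have [B qB] := horner_mx_invmx_reciprocal uA nzq recq.
(* The factorization passes from q to its associate: e_i(A^-1) = q(A) B a(A^-1) = e_i(A) b(A) B
   a(A^-1). *)
case/andP: qe => /dvdpP[a ea] /dvdpP[b qb].
exists (horner_mx A b *m B *m horner_mx (invmx A) a).
rewrite {1}ea mulrC rmorphM /= qB {1}qb mulrC rmorphM /=.
by rewrite !mulmxA.
Qed.

End Invertible.

(** * Integer matrices viewed over the rationals *)

Theorem theorem2 (n : nat) (hn : (2 <= n)%N) (M : 'M[int]_n)
    (hM : M \in unitmx) :
  let MQ : 'M[rat]_n := map_mx intr M in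
  (reversible MQ <->
     forall i : nat, (1 <= i <= num_invariants MQ)%N ->
       reciprocal (invariant_factor MQ i))
  /\ (reversible MQ ->
        exists G : 'M[rat]_n, reverses G MQ /\ involution G).
Proof.
case: n hn M hM => // n _ M hM MQ.
have uM : MQ \in unitmx.
  by move: hM; rewrite !unitmxE det_map_mx; apply: rmorph_unit.
have rec : reversible MQ -> forall i, (1 <= i <= num_invariants MQ)%N ->
    reciprocal (invariant_factor MQ i).
  by move=> revM i; apply: invariant_factor_reciprocal.
split; last by move/rec; apply: reversing_involution.
split=> // /(reversing_involution uM)[G [GM _]].
by exists G.
Qed.
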